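(* Let $n$ be a positive integer. All downsets $\mathcal{D}$ with $|U(\mathcal{D})|\le n$ have the star property if and only if the optimal objective value of the integer program $O_n$ is zero.
   Context: Let $[n]=\{1,\dots,n\}$ and $2^{[n]}$ its power set. A family is a set of subsets of a finite ground set; $U(\mathcal{F})$ is the union of all sets in $\mathcal{F}$. A family $\mathcal{D}$ is a downset if $A\in\mathcal{D}$, $B\subseteq A$ imply $B\in\mathcal{D}$. A family is intersecting if any two of its sets have nonempty intersection; it is a star if some element of $U(\mathcal{F})$ lies in all its sets; $\mathcal{F}$ has the star property if some maximum-cardinality intersecting family contained in $\mathcal{F}$ is a star. The integer program $O_n$ has binary variables $x_S,y_S\in\{0,1\}$ for all $S\in 2^{[n]}$ and an integer variable $z\in\mathbb{Z}_{\ge 0}$, objective $\max \sum_{S\in 2^{[n]}\setminus\{\emptyset\}} y_S - z$, and constraints: (i) $y_T+y_S\le 1$ for all nonempty $S,T\in 2^{[n]}$ with $S\cap T=\emptyset$; (ii) $\sum_{S\in 2^{[n]}: i\in S} x_S\le z$ for all $i\in[n]$; (iii) $y_T\le x_S$ for all $S,T\in 2^{[n]}$ with $S\subseteq T$.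
   Formalization: The empty family is counted as a star, so the downsets {} and {∅} have the star property; read literally they would lack it, and the equivalence would fail, e.g. for n = 1 and D = {∅}, where the optimum is zero. *)

(* Defs.v *)
From mathcomp Require Import all_boot all_order all_algebra.

Set Implicit Arguments.
Unset Strict Implicit.
Unset Printing Implicit Defensive.

Import Order.TTheory GRing.Theory Num.Theory.

Local Open Scope ring_scope.

(* A family over a finite ground set [T] is a [{set {set T}}], and U(F), the
   union of its members, is [cover F]. *)

Definition downset (T : finType) (D : {set {set T}}) : Prop :=
  forall A B : {set T}, A \in D -> B \subset A -> B \in D.

(* [A] and [B] may coincide, so an intersecting family never contains the
   empty set. *)
Definition intersecting (T : finType) (F : {set {set T}}) : Prop :=
  forall A B : {set T}, A \in F -> B \in F -> A :&: B != set0.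

(* The empty family counts as a star. This only matters for the downsets
   [set0] and [[set set0]]: their only intersecting subfamily is empty and
   they must not count as lacking the star property. *)
Definition is_star (T : finType) (F : {set {set T}}) : Prop :=
  F = set0 \/
  exists2 i : T, i \in cover F & forall A : {set T}, A \in F -> i \in A.

Definition max_intersecting_in (T : finType) (D F : {set {set T}}) : Prop :=
  [/\ F \subset D, intersecting F &
      forall G : {set {set T}},
        G \subset D -> intersecting G -> (#|G| <= #|F|)%N].

Definition star_property (T : finType) (D : {set {set T}}) : Prop :=
  exists2 F : {set {set T}}, max_intersecting_in D F & is_star F.

(* The ground set [n] = {1, ..., n} is encoded as ['I_n]. *)
Record O_point (n : nat) := OPoint {
  xvar : {set 'I_n} -> int;
  yvar : {set 'I_n} -> int;
  zvar : int
}.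

Definition binary (a : int) : Prop := a = 0 \/ a = 1.

Record O_feasible (n : nat) (p : O_point n) : Prop := OFeasible {
  O_xbinary : forall S : {set 'I_n}, binary (xvar p S);
  O_ybinary : forall S : {set 'I_n}, binary (yvar p S);
  O_znonneg : 0 <= zvar p;
  O_intersecting : forall S T : {set 'I_n},
    S != set0 -> T != set0 -> S :&: T = set0 -> yvar p T + yvar p S <= 1;
  O_degree : forall i : 'I_n,
    \sum_(S : {set 'I_n} | i \in S) xvar p S <= zvar p;
  O_downset : forall S T : {set 'I_n}, S \subset T -> yvar p T <= xvar p S
}.

Definition O_objective (n : nat) (p : O_point n) : int :=
  \sum_(S : {set 'I_n} | S != set0) yvar p S - zvar p.

Definition O_optimal_value (n : nat) (v : int) : Prop :=
  (exists2 p : O_point n, O_feasible p & O_objective p = v) /\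
  (forall p : O_point n, O_feasible p -> O_objective p <= v).

(* Main.v *)
(** Identify a downset [D] and an intersecting subfamily [F] with indicator
    vectors [x] and [y], and take for [z] the largest degree of [D], i.e. the
    size of its largest star: the objective is then [#|F|] minus that size.
    Conversely the nonempty sets [S] with [y_S = 1] form an intersecting family,
    the downset they generate lies in the support of [x], and its stars
    therefore have at most [z] members. *)
Require Import Defs.
From mathcomp Require Import all_boot all_order all_algebra.

Set Implicit Arguments.
Unset Strict Implicit.
Unset Printing Implicit Defensive.

Import Order.TTheory GRing.Theory Num.Theory.

Local Open Scope ring_scope.

Lemma sum_mem (I : finType) (P : pred I) (A : {set I}) :
  \sum_(i | P i) ((i \in A)%:R : int) = #|[set i in A | P i]|%:R.
Proof.
rewrite -natr_sum -sum1_card big_mkcond [in RHS]big_mkcond /=.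
congr (_%:R); apply: eq_bigr => i _; rewrite inE.
by case: (i \in A); case: (P i).
Qed.

Lemma binary_nat (b : bool) : binary b%:R.
Proof. by case: b; [right | left]. Qed.

(** * Stars, maximum intersecting subfamilies and generated downsets *)

Section Families.
Variable T : finType.
Implicit Types (A B : {set T}) (D F G : {set {set T}}) (t : T).

Definition star_at D t : {set {set T}} := [set A in D | t \in A].

Lemma star_at_intersecting D t : intersecting (star_at D t).
Proof.
move=> A B; rewrite !inE => /andP[_ tA] /andP[_ tB].
by apply/set0Pn; exists t; rewrite inE tA.
Qed.

Lemma exists_max_intersecting D : exists F, max_intersecting_in D F.
Proof.
pose P F := (F \subset D) && [forall A in F, forall B in F, A :&: B != set0].
have PP F : reflect (F \subset D /\ intersecting F) (P F).
  apply: (iffP andP) => -[FD FI]; split=> //.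
    move=> A B AF BF; move/forall_inP: FI => /(_ A AF) /forall_inP; exact.
  by apply/forall_inP=> A AF; apply/forall_inP=> B BF; apply: FI.
have P0 : P set0 by apply/PP; split=> [|A B]; rewrite ?sub0set ?inE.
case: (arg_maxnP (fun F => #|F|) P0) => F /PP[FD FI] maxF.
by exists F; split=> // G GD GI; apply/maxF/PP.
Qed.

(** A star of [D] is intersecting, so one with at least [#|F|] members is itself of maximum size. If
    [F] is empty, it is a star by convention. *)
Lemma star_property_of_large_star D F :
  max_intersecting_in D F ->
  (F != set0 -> exists t, (#|F| <= #|star_at D t|)%N) -> star_property D.
Proof.
move=> maxF; have [F0 _ | Fn0 /(_ isT)[t leFt]] := eqVneq F set0.
  by exists F => //; left.
case: maxF => _ _ maxF; exists (star_at D t).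
  split; last by move=> G GD GI; apply: leq_trans leFt; apply: maxF.
    by apply/subsetP => A; rewrite inE => /andP[].
  exact: star_at_intersecting.
right; exists t; last by move=> A; rewrite inE => /andP[].
(* [is_star] wants its centre in the cover; a member of the star at [t] witnesses this, and one
   exists because [F] is nonempty. *)
have /card_gt0P[A At]: (0 < #|star_at D t|)%N.
  by apply: leq_trans leFt; rewrite card_gt0.
by apply/bigcupP; exists A => //; move: At; rewrite inE => /andP[].
Qed.

Lemma star_le_star_at D F :
  F \subset D -> is_star F -> F != set0 ->
  exists t, (#|F| <= #|star_at D t|)%N.
Proof.
move=> FD [-> /eqP // | [t _ Ft] _]; exists t; apply: subset_leq_card.
by apply/subsetP => A AF; rewrite inE (subsetP FD) // Ft.
Qed.

Definition generated_downset F : {set {set T}} :=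
  [set A : {set T} | [exists B in F, A \subset B]].

Lemma generated_downsetP F A :
  reflect (exists2 B, B \in F & A \subset B) (A \in generated_downset F).
Proof. by rewrite inE; apply: (iffP exists_inP). Qed.

Lemma generated_downset_downset F : downset (generated_downset F).
Proof.
move=> A B /generated_downsetP[C CF AC] BA.
by apply/generated_downsetP; exists C => //; apply: subset_trans AC.
Qed.

Lemma sub_generated_downset F : F \subset generated_downset F.
Proof. by apply/subsetP=> A AF; apply/generated_downsetP; exists A. Qed.

End Families.

(** * Transport of families along a map injective on the covered elements *)

Section Image.
Variables (T U : finType) (f : T -> U).
Implicit Types (A B : {set T}) (D F : {set {set T}}).

Definition image_family F : {set {set U}} := [set f @: A | A : {set T} in F].

Lemma image_family_downset D : downset D -> downset (image_family D).
Proof.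
move=> dD _ S /imsetP[A AD ->] SfA.
(* This subset of [A] has image exactly [S], because [S] lies in [f @: A]. *)
apply/imsetP; exists (A :&: f @^-1: S).
  by apply: dD AD _; apply: subsetIl.
apply/setP => u; apply/idP/imsetP => [uS | [t + ->]]; last first.
  by rewrite !inE => /andP[].
have /imsetP[t tA ut] := subsetP SfA u uS.
by exists t => //; rewrite !inE tA -ut.
Qed.

Lemma image_family_intersecting F :
  intersecting F -> intersecting (image_family F).
Proof.
move=> FI _ _ /imsetP[A AF ->] /imsetP[B BF ->].
have /set0Pn[t] := FI A B AF BF; rewrite inE => /andP[tA tB].
by apply/set0Pn; exists (f t); rewrite inE !imset_f.
Qed.

Variable C : {set T}.
Hypothesis f_inj : {in C &, injective f}.

Lemma mem_imset_in A t : A \subset C -> t \in C -> (f t \in f @: A) = (t \in A).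
Proof.
move=> AC tC; apply/imsetP/idP => [[s sA /f_inj fts] | tA]; last by exists t.
by rewrite fts // (subsetP AC).
Qed.

Lemma imset_inj_in : {in [pred A : {set T} | A \subset C] &,
  injective (fun A => f @: A)}.
Proof.
move=> A B AC BC /= fAB; apply/setP=> t.
have [tC | tC] := boolP (t \in C); first by rewrite -(mem_imset_in AC) // fAB mem_imset_in.
by rewrite (contraNF (subsetP AC t)) // (contraNF (subsetP BC t)).
Qed.

Lemma card_image_family F : cover F \subset C -> #|image_family F| = #|F|.
Proof.
move=> FC; apply: card_in_imset => A B AF BF.
by apply: imset_inj_in; apply: subset_trans FC; apply: bigcup_sup.
Qed.

(** A member of the star provides a preimage [t] of [u] in [C]. By injectivity on [C], a set [B] of
    [D] contains [t] exactly when [f @: B] contains [u], and distinct sets have distinct images. *)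
Lemma star_at_image_family D u :
  cover D \subset C -> star_at (image_family D) u != set0 ->
  exists t, #|star_at (image_family D) u| = #|star_at D t|.
Proof.
move=> DC /set0Pn[S]; rewrite inE => /andP[/imsetP[A AD ->] /imsetP[t tA ->]].
have subC B : B \in D -> B \subset C.
  by move=> BD; apply: subset_trans DC; apply: bigcup_sup.
have tC : t \in C by apply: subsetP tA; apply: subC.
exists t; rewrite -card_image_family; last first.
  by apply/bigcupsP => B; rewrite inE => /andP[/subC].
congr #|pred_of_set _|; apply/setP=> S'; rewrite inE.
apply/andP/imsetP => [[/imsetP[B BD ->] ftB] | [B + ->]].
  by exists B => //; rewrite inE BD -mem_imset_in ?subC.
by rewrite inE => /andP[BD tB]; rewrite !imset_f.
Qed.

End Image.

(** Injectivity is asked on [C] alone, since [T] may have more than [n] elements. Elements of [C] go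
    to their positions in its enumeration; the others need some value, so ['I_n] must be
    inhabited. *)
Lemma exists_inj_ord (T : finType) (C : {set T}) (n : nat) :
  (0 < n)%N -> (#|C| <= n)%N -> exists f : T -> 'I_n, {in C &, injective f}.
Proof.
case: n => // n _ leCn; exists (fun t => inord (index t (enum C))) => s t sC tC.
have idx u : u \in C -> (index u (enum C) < n.+1)%N.
  by move=> uC; apply: leq_trans leCn; rewrite cardE index_mem mem_enum.
move/(congr1 val); rewrite /= !inordK ?idx // => /(index_inj s).
by apply; rewrite mem_enum.
Qed.

(** * Feasible points of the program versus families on ['I_n] *)

Section Program.
Variable n : nat.
Implicit Types (D F : {set {set 'I_n}}) (p : O_point n).

(** The empty set is left out: the disjointness constraints do not bound its [yvar], the objective
    ignores it, and no intersecting family contains it. *)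
Definition support_y p : {set {set 'I_n}} :=
  [set S | (S != set0) && (yvar p S == 1)].

Lemma objective_support p :
  O_feasible p -> O_objective p = #|support_y p|%:R - zvar p.
Proof.
move=> fp; rewrite /O_objective; congr (_ - _).
transitivity (\sum_(S : {set 'I_n} | S != set0) ((S \in support_y p)%:R : int)).
  apply: eq_bigr => S Sn0; rewrite inE Sn0 /=.
  by case: (O_ybinary fp S) => ->.
rewrite sum_mem; congr (#|pred_of_set _|%:R).
by apply/setP=> S; rewrite !inE andbC andbA andbb.
Qed.

Lemma support_y_intersecting p : O_feasible p -> intersecting (support_y p).
Proof.
move=> fp S S'; rewrite !inE => /andP[Sn0 /eqP yS] /andP[S'n0 /eqP yS'].
apply/negP => /eqP SS'0.
by have := O_intersecting fp Sn0 S'n0 SS'0; rewrite yS yS'.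
Qed.

(** The support of [xvar p] need not be a downset, hence the passage to the generated one. The
    degree sum dominates the star termwise: [xvar p S] is at least [yvar p B = 1] when [S] lies
    below some [B] of the support, and nonnegative otherwise. *)
Lemma star_at_generated_le p i :
  O_feasible p -> #|star_at (generated_downset (support_y p)) i|%:R <= zvar p.
Proof.
move=> fp; apply: le_trans (O_degree fp i); rewrite -sum_mem.
apply: ler_sum => S _; case: generated_downsetP => [[B BY SB] | _].
  by move: BY; rewrite inE => /andP[_ /eqP <-]; apply: O_downset fp _ _ SB.
by case: (O_xbinary fp S) => ->.
Qed.

Lemma objective_le0 p :
  O_feasible p -> star_property (generated_downset (support_y p)) ->
  O_objective p <= 0.
Proof.
move=> fp [F [FD _ maxF] starF]; rewrite objective_support // subr_le0.
have leYF := maxF _ (sub_generated_downset _) (support_y_intersecting fp).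
apply: (@le_trans _ _ #|F|%:R); first by rewrite ler_nat.
(* An empty star has no centre, so here the bound comes from the sign of [zvar p]. *)
have [-> | Fn0] := eqVneq F set0; first by rewrite cards0 O_znonneg.
have [i leFi] := star_le_star_at FD starF Fn0.
by apply: le_trans (star_at_generated_le i fp); rewrite ler_nat.
Qed.

(** The chosen [zvar] is the least value that the degree constraints allow, which makes the
    objective as large as possible for given [D] and [F]. *)
Definition family_point D F : O_point n :=
  OPoint (fun S => (S \in D)%:R) (fun S => (S \in F)%:R)
    (\max_(i < n) #|star_at D i|)%:R.

Lemma family_point_feasible D F :
  downset D -> F \subset D -> intersecting F -> O_feasible (family_point D F).
Proof.
move=> dD FD FI; split=> /= [S|S||S S' Sn0 S'n0 SS'0|i|S S' SS'].
- exact: binary_nat.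
- exact: binary_nat.
- exact: ler0n.
- have [S'F | _] := boolP (S' \in F); last by case: (S \in F).
  have [SF | _] := boolP (S \in F); last by [].
  by have := FI S S' SF S'F; rewrite SS'0 eqxx.
- by rewrite sum_mem ler_nat (@leq_bigmax _ (fun j => #|star_at D j|)).
- have [S'F | _] := boolP (S' \in F); last exact: ler0n.
  by rewrite (dD S') // (subsetP FD).
Qed.

Lemma family_point_objective D F :
  intersecting F ->
  O_objective (family_point D F) = #|F|%:R - (\max_(i < n) #|star_at D i|)%:R.
Proof.
move=> FI; rewrite /O_objective /= sum_mem; congr (#|pred_of_set _|%:R - _).
(* Summing over nonempty sets loses nothing: a member of [F] meets itself, so it is nonempty. *)
apply/setP=> S; rewrite inE; apply: andb_idr => SF.
by have := FI S S SF SF; rewrite setIid.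
Qed.

Lemma family_point00_objective : O_objective (family_point set0 set0) = 0.
Proof.
rewrite family_point_objective; last by move=> A B; rewrite inE.
rewrite cards0 big1 ?subrr // => i _.
by apply/eqP; rewrite cards_eq0; apply/eqP/setP=> S; rewrite !inE.
Qed.

Lemma family_point00_feasible : O_feasible (family_point set0 set0).
Proof. by apply: family_point_feasible => [A B||A B]; rewrite ?inE. Qed.

End Program.

Theorem theorem2p3 (n : nat) (hn : (0 < n)%N) :
  (forall (T : finType) (D : {set {set T}}),
     downset D -> (#|cover D| <= n)%N -> star_property D) <->
  O_optimal_value n 0%R.
Proof.
split=> [star | [_ le0] T D dD leDn].
  split=> [|p fp].
    (* The zero point attains the value 0, so only the upper bound depends on the star property. *)
    exists (family_point set0 set0); first exact: family_point00_feasible.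
    exact: family_point00_objective.
  apply: objective_le0 => //; apply: star; first exact: generated_downset_downset.
  by apply: leq_trans (max_card _) _; rewrite card_ord.
have [F maxF] := exists_max_intersecting D.
apply: star_property_of_large_star (maxF) _ => Fn0.
have [f f_inj] := exists_inj_ord hn leDn; case: maxF => FD FI _.
have fFI := image_family_intersecting (f := f) FI.
(* The bound for the images of [D] and [F] says that some degree of the image of [D] is at least
   [#|F|]. *)
have := le0 _ (family_point_feasible (image_family_downset (f := f) dD)
  (imsetS _ FD) fFI).
rewrite family_point_objective // subr_le0 ler_nat (card_image_family f_inj);
  last first.
  by apply/bigcupsP=> A AF; apply: bigcup_sup; apply: subsetP AF.
(* The maximum is attained since [n] is positive. The star at [i] has at least [#|F|] members, so it
   is nonempty and comes from a star of [D] of the same size. *)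
have [|i ->] := @bigop.eq_bigmax _ (fun i => #|star_at (image_family f D) i|).
  by rewrite card_ord.
move=> leFi; have [||t eqit] := star_at_image_family (u := i) f_inj (D := D).
- exact: subxx.
- by rewrite -card_gt0; apply: leq_trans leFi; rewrite card_gt0.
by exists t; rewrite -eqit.
Qed.
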